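(* If a distribution $P$ over an exchangeable random network with $n$ nodes is faithful to a chain mixed graph $G$ (whose vertices are the dyads of the network), then $G$ is Markov equivalent to one of the following graphs: \begin{enumerate} \item the empty graph; \item the undirected incidence graph $L_{-}(n)$; \item the bidirected incidence graph $L_{\leftrightarrow}(n)$; \item the undirected complement of the incidence graph, $L^c_{-}(n)$; \item the bidirected complement of the incidence graph, $L^c_{\leftrightarrow}(n)$; \item the complete graph. \end{enumerate}
   Context: Networks. Let $\mathcal N$ be a finite set of $n$ nodes and $\mathcal D$ the set of dyads, i.e. all two-element subsets of $\mathcal N$; the dyad $\{i,j\}$ is written $ij=ji$. A random network is a family $X=(X_d)_{d\in\mathcal D}$ of $\{0,1\}$-valued random variables with joint distribution $P$. It is exchangeable if for every permutation $\pi$ of $\mathcal N$ and all values $x$, $P\{X_{ij}=x_{ij}\ \forall ij\in\mathcal D\}=P\{X_{ij}=x_{\pi(i)\pi(j)}\ \forall ij\in\mathcal D\}$. For pairwise disjoint $A,B,C\subseteq\mathcal D$, $A\perp\!\!\!\perp B\mid C$ denotes conditional independence of $X_A$ and $X_B$ given $X_C$ under $P$. Graphs. A mixed graph may have three types of edges: lines (undirected edges), arrows (directed edges), arcs (bidirected edges, with an arrowhead at each endpoint). Graphs are simple: no loops, and at most one edge between two vertices. A chain mixed graph is a mixed graph with no semi-directed cycle, i.e. no cycle consisting only of lines and arrows, with at least one arrow, and with all arrows pointing in the same direction along the cycle. A walk is a list $\langle i_0,e_1,i_1,\dots,e_r,i_r\rangle$ of vertices and edges with $e_m$ having endpoints $i_{m-1},i_m$.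 A section of a walk is a maximal subwalk consisting only of lines (possibly a single vertex). A section $\rho$ of a walk is a collider section if it is both preceded and followed on the walk by an edge, each being an arrow or arc with an arrowhead at the endpoint of $\rho$ (that is $i\to\rho\leftarrow j$, $i\leftrightarrow\rho\leftarrow j$, $i\to\rho\leftrightarrow j$ or $i\leftrightarrow\rho\leftrightarrow j$); all other sections are non-collider. A walk is connecting given $C$ if every collider section of it intersects $C$ and every non-collider section is disjoint from $C$. For pairwise disjoint vertex sets $A,B,C$, $A\perp B\mid C$ in $G$ (separation) means that no walk between $A$ and $B$ is connecting given $C$. $P$ is faithful to $G$ (vertex set $\mathcal D$) if for all pairwise disjoint $A,B,C\subseteq\mathcal D$: $A\perp B\mid C$ in $G$ $\iff$ $A\perp\!\!\!\perp B\mid C$. Two graphs on the same vertex set are Markov equivalent if they induce exactly the same separations. The incidence graph on $n$ nodes has vertex set $\mathcal D$, with two distinct dyads adjacent iff they share a node. $L_{-}(n)$ is this graph with all edges lines, $L_{\leftrightarrow}(n)$ with all edges arcs. Its complement has two distinct dyads adjacent iff they share no node; $L^c_{-}(n)$ and $L^c_{\leftrightarrow}(n)$ are the complement with all edges lines, respectively arcs. The empty graph on $\mathcal D$ has no edges, and the complete graph has all edges. *)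

(* Defs.v *)
(* MathComp and MathComp-Analysis. *)
From HB Require Import structures.
From mathcomp Require Import all_boot all_order all_algebra perm.
From mathcomp Require Import boolp classical_sets reals ereal measure random_variable.

Set Implicit Arguments.
Unset Strict Implicit.
Unset Printing Implicit Defensive.

Import Order.TTheory GRing.Theory Num.Theory.

Definition dyad (N : finType) := {d : {set N} | #|d| == 2}.

Lemma dyad_perm_subproof (N : finType) (s : {perm N}) (d : dyad N) :
  #|s @: val d| == 2.
Proof. by rewrite card_imset ?(valP d)//; exact: perm_inj. Qed.

(* The dyad ij is sent to s(i)s(j). *)
Definition dyad_perm (N : finType) (s : {perm N}) (d : dyad N) : dyad N :=
  exist _ (s @: val d) (dyad_perm_subproof s d).

Section Probability.
Local Open Scope classical_set_scope.
Local Open Scope ring_scope.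
Context (disp : measure_display) (Omega : measurableType disp) (R : realType).
Variable P : probability Omega R.

Definition cond_prob (E F : set Omega) : R := fine (P (E `&` F)) / fine (P F).

Section Family.
Variables (V : finType) (X : V -> {RV P >-> bool}).

Definition agree_on (A : {set V}) (x : V -> bool) : set Omega :=
  [set w | forall v, v \in A -> X v w = x v].

(* X_A and X_B independent given X_C; x only matters on A, B and C, and ranges
   over all their joint values. *)
Definition cond_indep (A B C : {set V}) : Prop :=
  forall x : V -> bool, (0 < P (agree_on C x))%E ->
    cond_prob (agree_on A x `&` agree_on B x) (agree_on C x) =
    cond_prob (agree_on A x) (agree_on C x) *
    cond_prob (agree_on B x) (agree_on C x).

End Family.

Definition exchangeable (N : finType) (X : dyad N -> {RV P >-> bool}) : Prop :=
  forall (s : {perm N}) (x : dyad N -> bool),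
    P [set w | forall d, X d w = x d] =
    P [set w | forall d, X d w = x (dyad_perm s d)].

End Probability.

(* The type of an edge read from its first endpoint u to its second endpoint v:
   ArrowTo is u -> v, ArrowFrom is u <- v. *)
Inductive edge_type := Line | ArrowTo | ArrowFrom | Arc.

Definition rev_edge_type (t : edge_type) : edge_type :=
  match t with
  | Line => Line
  | ArrowTo => ArrowFrom
  | ArrowFrom => ArrowTo
  | Arc => Arc
  end.

Definition is_line (e : option edge_type) : bool :=
  if e is Some Line then true else false.

Definition is_arrow_to (e : option edge_type) : bool :=
  if e is Some ArrowTo then true else false.

Definition head_at_fst (e : option edge_type) : bool :=
  match e with Some ArrowFrom | Some Arc => true | _ => false end.

Definition head_at_snd (e : option edge_type) : bool :=
  match e with Some ArrowTo | Some Arc => true | _ => false end.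

(* edge u v = None when u and v are not adjacent; being a function, it makes
   the graph simple. *)
Record mixed_graph (V : finType) := MixedGraph {
  edge :> V -> V -> option edge_type;
  edge_irrefl : forall v, edge v v = None;
  edge_sym : forall u v, edge v u = omap rev_edge_type (edge u v)
}.

Section Graphs.
Variable V : finType.
Implicit Types (G H : mixed_graph V) (A B C : {set V}).

Definition adjacent G : rel V := fun u v => isSome (G u v).

(* c lists the distinct vertices of the cycle, in the direction of its arrows.
   An edge from the last vertex back to the first is required; simplicity of G
   and the presence of an arrow force at least three vertices. *)
Definition semi_directed_cycle G (c : seq V) : bool :=
  [&& uniq c,
      cycle (fun u v => is_line (G u v) || is_arrow_to (G u v)) c &
      has (fun u => is_arrow_to (G u (next c u))) c].

Definition chain_mixed G : Prop := forall c, ~~ semi_directed_cycle G c.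

(* As G is simple, a walk is given by its nonempty vertex list x :: p with
   consecutive vertices adjacent, and a section by the indices a <= b of its
   first and last vertices. *)
Section Walk.
Variables (G : mixed_graph V) (x : V) (p : seq V).

Definition vtx (k : nat) : V := nth x (x :: p) k.
Definition step (k : nat) : option edge_type := G (vtx k) (vtx k.+1).

Definition walk_section (a b : nat) : Prop :=
  [/\ a <= b <= size p,
      forall k, a <= k < b -> is_line (step k),
      0 < a -> ~~ is_line (step a.-1)
    & b < size p -> ~~ is_line (step b)].

Definition collider_section (a b : nat) : bool :=
  [&& 0 < a, b < size p, head_at_snd (step a.-1) & head_at_fst (step b)].

Definition section_meets (a b : nat) C : Prop :=
  exists2 k, a <= k <= b & vtx k \in C.

Definition connecting C : Prop :=
  forall a b, walk_section a b ->
    if collider_section a b then section_meets a b C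
    else ~ section_meets a b C.

End Walk.

Definition separated G A B C : Prop :=
  forall (x : V) (p : seq V),
    path (adjacent G) x p -> x \in A -> last x p \in B ->
    ~ connecting G x p C.

Definition pairwise_disjoint A B C : Prop :=
  [/\ [disjoint A & B], [disjoint A & C] & [disjoint B & C]].

Definition markov_equivalent G H : Prop :=
  forall A B C, pairwise_disjoint A B C ->
    separated G A B C <-> separated H A B C.

End Graphs.

Definition faithful (disp : measure_display) (Omega : measurableType disp)
    (R : realType) (P : probability Omega R) (V : finType)
    (X : V -> {RV P >-> bool}) (G : mixed_graph V) : Prop :=
  forall A B C : {set V}, pairwise_disjoint A B C ->
    separated G A B C <-> cond_indep X A B C.

Section UniformGraphs.
Context (V : finType) (t : edge_type) (t_sym : rev_edge_type t = t).
Context (e : rel V) (e_sym : symmetric e).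

Definition uniform_edge (u v : V) : option edge_type :=
  if (u != v) && e u v then Some t else None.

Lemma uniform_irrefl v : uniform_edge v v = None.
Proof. by rewrite /uniform_edge eqxx. Qed.

Lemma uniform_sym u v : uniform_edge v u = omap rev_edge_type (uniform_edge u v).
Proof. by rewrite /uniform_edge eq_sym e_sym; case: ifP => //=; rewrite t_sym. Qed.

Definition uniform_graph : mixed_graph V :=
  MixedGraph uniform_irrefl uniform_sym.

End UniformGraphs.

Section NamedGraphs.
Variable N : finType.

Definition share_node : rel (dyad N) :=
  fun d d' => [exists i, (i \in val d) && (i \in val d')].
Definition share_no_node : rel (dyad N) := fun d d' => ~~ share_node d d'.

Lemma share_node_sym : symmetric share_node.
Proof. by move=> d d'; apply: eq_existsb => i; rewrite andbC. Qed.

Lemma share_no_node_sym : symmetric share_no_node.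
Proof. by move=> d d'; rewrite /share_no_node share_node_sym. Qed.

Definition incidence_lines : mixed_graph (dyad N) :=
  uniform_graph (erefl : rev_edge_type Line = Line) share_node_sym.

Definition incidence_arcs : mixed_graph (dyad N) :=
  uniform_graph (erefl : rev_edge_type Arc = Arc) share_node_sym.

Definition incidence_compl_lines : mixed_graph (dyad N) :=
  uniform_graph (erefl : rev_edge_type Line = Line) share_no_node_sym.

Definition incidence_compl_arcs : mixed_graph (dyad N) :=
  uniform_graph (erefl : rev_edge_type Arc = Arc) share_no_node_sym.

End NamedGraphs.

Definition empty_graph (V : finType) : mixed_graph V :=
  MixedGraph (edge := fun _ _ : V => None) (fun _ => erefl) (fun _ _ => erefl).

(* Adjacent vertices are never separated, so the edge types of a complete graph
   are immaterial up to Markov equivalence; lines are used. *)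
Definition complete_graph (V : finType) : mixed_graph V :=
  uniform_graph (erefl : rev_edge_type Line = Line)
    (e := fun _ _ : V => true) (fun _ _ => erefl).

(* Main.v *)
Require Import Defs.
From mathcomp Require Import all_boot all_order all_algebra perm.
From mathcomp Require Import boolp classical_sets reals ereal measure random_variable.
From Stdlib Require Import Relation_Operators Operators_Properties.
From mathcomp Require Import functions cardinality fsbigop fintype finset.
Import Defs.

(** Write [connected C i j] when some walk from i to j is connecting given C.  A
    walk joins two single vertices, so separation of sets amounts to separation
    of their elements, and the proof is about the triples (i, j, C).

    Exchangeability makes conditional independence invariant under permutations
    of the nodes; faithfulness carries this over to [connected].  Call two dyads
    inseparable when they are connected given every C, as adjacent ones are.  The
    permutations of the nodes have at most two orbits on ordered pairs of distinct
    dyads, those that share a node and those that do not, so inseparability holds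
    on all or none of each ([orbit_inseparable]).  If no pair is inseparable then G has
    no edge; if all are then nothing is separated.  In the two remaining cases
    inseparability of distinct dyads is [e], one of [share_node] and
    [share_no_node].

    If G has only arcs, a walk between distinct vertices that is connecting given
    the empty set is a single edge
    ([connected_set0_adjacent]), so inseparable pairs are adjacent and G is the
    bidirected graph of [e].

    Otherwise G has an edge from v to w that is a line or an arrow.  Such a v is
    anterior to w, hence conditioning on v as well as on C keeps i and j
    separated whenever w is one of i, j or belongs to C ([connected_anterior]):
    a collider section opened by v can be bypassed by way of w.  By symmetry
    the same holds for all pairs in [e], which is symmetric, and this single
    instance of ordered stability makes the separations of G those of the
    undirected graph of [e]:
    - a separating set of i and j can be enlarged, along [e], until it contains
      all other vertices ([not_connected_given_rest]); the intersection property
      ([connected_intersection]) then lets one descend to any C that separates i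
      and j in [e] ([connected_connect_avoiding]);
    - if an [e]-path from i to j avoids C and its second vertex is k, then a
      separation of i and j given C persists given k and C, and singleton
      transitivity ([connected_transitivity]) separates i and k, which is absurd,
      or k and j, which are joined by a shorter path
      ([connect_avoiding_connected]).

    The properties of [connected] rest on cutting, joining and rerouting walks.
    Sections are awkward under these operations, so a connecting walk is
    described by an automaton that runs along it and guesses, on entering a
    section by an arrowhead, whether the section will be a collider. *)

Set Implicit Arguments.
Unset Strict Implicit.
Unset Printing Implicit Defensive.

(** * Connecting walks, read from left to right *)

Section Walks.
Variables (V : finType) (G : mixed_graph V).
Implicit Types (C D : {set V}) (x y i j : V) (p : seq V) (h m : bool).

(** The flags summarise what precedes x on the walk: h, whether the current
    section is entered by an arrowhead; m, whether it has already met C. *)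
Fixpoint connecting_from C (h m : bool) x (p : seq V) : bool :=
  let m' := m || (x \in C) in
  if p is y :: p' then
    if is_line (G x y) then connecting_from C h m' y p'
    else (m' == h && head_at_fst (G x y))
         && connecting_from C (head_at_snd (G x y)) false y p'
  else ~~ m'.

Definition head_before h x p a : bool :=
  if a is a'.+1 then head_at_snd (step G x p a') else h.

Definition section_ok C (h m : bool) x p a b : Prop :=
  let met := (a = 0 /\ m) \/ section_meets x p a b C in
  if [&& head_before h x p a, b < size p & head_at_fst (step G x p b)]
  then met else ~ met.

Lemma vtx_shift x y p k : k <= size p -> vtx x (y :: p) k.+1 = vtx y p k.
Proof. by move=> kp; rewrite /vtx /=; apply: set_nth_default. Qed.

Lemma step_shift x y p k :
  k < size p -> step G x (y :: p) k.+1 = step G y p k.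
Proof. by move=> kp; rewrite /step !vtx_shift // ltnW. Qed.

Lemma step0 x y p : step G x (y :: p) 0 = G x y.
Proof. by []. Qed.

(** An initial line would merge x into the first section of the rest, whence the
    hypothesis; later sections are not affected by the first edge. *)
Lemma walk_section_shift x y p a b :
  (a = 0 -> ~~ is_line (G x y)) ->
  walk_section G x (y :: p) a.+1 b.+1 <-> walk_section G y p a b.
Proof.
move=> a0; split=> -[/andP[le_ab le_bp] lines before after]; split.
- exact/andP.
- move=> k /andP[ak kb]; rewrite -(@step_shift x) ?(leq_trans kb) //.
  by apply: lines; rewrite !ltnS ak.
- case: a before {a0 lines} le_ab => // a before ab _; rewrite ltnS in ab.
  by rewrite -(@step_shift x) /= ?(leq_trans ab) //; apply: before.
- by move=> bp; rewrite -(@step_shift x) //; apply: after.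
- exact/andP.
- case=> // k /andP[]; rewrite !ltnS => ak kb.
  by rewrite step_shift ?(leq_trans kb) //; apply: lines; rewrite ak.
- case: a before a0 {lines} le_ab => [_ a0 _ _ /=|a before _ ab _ /=]; first exact: a0.
  by rewrite step_shift /= ?(leq_trans ab) //; apply: before.
- by move=> bp; rewrite step_shift //; apply: after.
Qed.

Lemma walk_section_line x y p b : is_line (G x y) ->
  walk_section G x (y :: p) 0 b.+1 <-> walk_section G y p 0 b.
Proof.
move=> xy; split=> -[le_bp lines before after]; split=> //.
- move=> k kb; rewrite -(@step_shift x) ?(leq_trans kb) //.
  exact: lines.
- by move=> bp; rewrite -(@step_shift x) //; apply: after.
- case=> // k; rewrite /= ltnS => kb.
  by rewrite step_shift ?(leq_trans kb) //; apply: lines.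
- by move=> bp; rewrite step_shift //; apply: after.
Qed.

Lemma section_meets_shift C x y p a b : b <= size p ->
  section_meets x (y :: p) a.+1 b.+1 C <-> section_meets y p a b C.
Proof.
move=> bp; split=> [[[|k] // /andP[]]|[k /andP[ak kb] kC]].
  rewrite !ltnS => ak kb; rewrite vtx_shift ?(leq_trans kb) // => kC.
  by exists k; rewrite ?ak.
by exists k.+1; rewrite ?vtx_shift ?ltnS ?ak ?(leq_trans kb).
Qed.

Lemma section_meets_line C x y p b : b <= size p ->
  section_meets x (y :: p) 0 b.+1 C <-> x \in C \/ section_meets y p 0 b C.
Proof.
move=> bp; split=> [[[|k]] //|[xC|[k kb kC]]].
- by left.
- rewrite /= ltnS => kb; rewrite vtx_shift ?(leq_trans kb) // => kC.
  by right; exists k.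
- by exists 0.
- by exists k.+1; rewrite ?vtx_shift // (leq_trans kb).
Qed.

Lemma section_meets0 C x p : section_meets x p 0 0 C <-> x \in C.
Proof.
by split=> [[k]|xC]; [rewrite leqn0 => /eqP ->|exists 0].
Qed.

Lemma section_ok_line C h m x y p b : b <= size p ->
  section_ok C h m x (y :: p) 0 b.+1 <->
  section_ok C h (m || (x \in C)) y p 0 b.
Proof.
move=> bp; have M := section_meets_line C x y bp; rewrite /section_ok /= ltnS.
have E : (0 = 0 /\ m || (x \in C)) <-> (0 = 0 /\ m) \/ x \in C.
  split; first by case=> _ /orP[]; [left|right].
  by case=> [[_ ->]|->]; rewrite ?orbT.
case: ltnP => bp'; last by rewrite andbF; tauto.
by rewrite step_shift //=; case: ifP => _; tauto.
Qed.

Lemma section_ok_shift C h h' m m' x y p a b : a <= b <= size p ->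
  (a = 0 -> h' = head_at_snd (G x y) /\ m' = false) ->
  section_ok C h m x (y :: p) a.+1 b.+1 <-> section_ok C h' m' y p a b.
Proof.
case/andP=> ab bp hm'; have M := section_meets_shift C x y a bp.
have Em : (a.+1 = 0 /\ m) <-> (a = 0 /\ m').
  by split=> -[// a0]; have [_ ->] := hm' a0.
have Eh : head_at_snd (step G x (y :: p) a) = head_before h' y p a.
  case: a ab {M Em} hm' => [_ []// -> //|a ab _ /=].
  by rewrite step_shift // (leq_trans ab).
rewrite /section_ok /= ltnS Eh.
case: ltnP => bp'; last by rewrite andbF; tauto.
by rewrite step_shift //=; case: ifP => _; tauto.
Qed.

Lemma met0 C m x p :
  (0 = 0 /\ m) \/ section_meets x p 0 0 C <-> m || (x \in C).
Proof.
have M := section_meets0 C x p; split=> [[[_ ->] //|/M ->]|/orP[]].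
- by rewrite orbT.
- by left.
- by move/M; right.
Qed.

Lemma section_ok0 C h m x y p :
  section_ok C h m x (y :: p) 0 0 <->
  (m || (x \in C)) == (h && head_at_fst (G x y)).
Proof.
rewrite /section_ok /= step0; case: (h && _); rewrite ?eqb_id ?eqbF_neg.
  exact: met0.
by split=> [nmet|/negP nmet /met0 //]; apply/negP => /met0.
Qed.

Lemma section_ok_nil C h m x : section_ok C h m x [::] 0 0 <-> ~~ (m || (x \in C)).
Proof.
rewrite /section_ok /= andbF.
by split=> [nmet|/negP nmet /met0 //]; apply/negP => /met0.
Qed.

(** Induction on the walk.  A first edge that is a line extends the first section
    of the rest by one vertex; any other first edge makes [x] a section of its
    own. *)
Lemma connecting_fromP C h m x p :
  connecting_from C h m x p <->
  forall a b, walk_section G x p a b -> section_ok C h m x p a b.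
Proof.
elim: p h m x => [|y p IH] h m x /=.
  rewrite -(section_ok_nil _ h); split=> [ok a b [/andP[ab b0] _ _ _]|]; last exact.
  by case: b a b0 ab => // -[].
case: ifPn => xy.
  rewrite IH; split=> H [|a] [|b] sec.
  - by case: sec => _ _ _ /(_ isT); rewrite step0 xy.
  - rewrite section_ok_line; last by case: sec.
    by apply: H; rewrite -(walk_section_line p b xy).
  - by case: sec.
  - have a0 : a <> 0.
      by move=> a0; case: sec => _ _ /(_ isT); rewrite a0 step0 xy.
    have ab : a <= b <= size p by case: sec.
    apply/(@section_ok_shift _ _ h _ (m || (x \in C))) => //.
    by apply: H; apply/(@walk_section_shift x).
  - rewrite -section_ok_line //; apply: H.
    by rewrite walk_section_line.
  - rewrite -section_ok_line; last by case: sec.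
    by apply: H; rewrite walk_section_line.
  - by case: sec.
  - apply/(@section_ok_shift _ h _ m _ x) => //; first by case: sec.
    by apply: H; apply/walk_section_shift.
split=> [/andP[ok0 /IH H] [|a] [|b] sec|H].
- by rewrite section_ok0.
- by case: sec => _ /(_ 0 isT); rewrite step0 (negPf xy).
- by case: sec.
- apply/(@section_ok_shift _ _ (head_at_snd (G x y)) _ false) => //; first by case: sec.
  by apply: H; rewrite -(@walk_section_shift x).
have sec0 : walk_section G x (y :: p) 0 0 by split=> // k /andP[_]; rewrite ltn0.
have /section_ok0 -> /= := H 0 0 sec0.
apply/IH => a b sec.
apply/(@section_ok_shift C h _ m _ x) => //; first by case: sec.
by apply: H; rewrite walk_section_shift.
Qed.

Lemma connecting_from_start C x p :
  connecting G x p C <-> connecting_from C false false x p.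
Proof.
have E a b : section_ok C false false x p a b <->
    if collider_section G x p a b then section_meets x p a b C
    else ~ section_meets x p a b C.
  rewrite /section_ok /collider_section; case: a => [|a] /=; first by intuition.
  by rewrite andbCA; case: ifP => _; intuition.
by rewrite connecting_fromP; split=> H a b /(H a b) /E.
Qed.
End Walks.

(** * Connecting walks as paths of an automaton *)

(** The mode at a vertex of a walk says what is claimed about its section: [Open]
    and [Headed], that it is a non-collider, with the arrowhead at its left end
    absent, respectively present; [Sought] and [Found], that it is a collider,
    where [Found] asserts that it has already met C. *)
Inductive mode := Open | Headed | Sought | Found.

Definition noncollider (s : mode) : bool :=
  if s is (Open | Headed) then true else false.

(** Passing along a line; [c] tells whether the new vertex is in C. *)
Definition continues (s s' : mode) (c : bool) : bool :=
  match s, s' with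
  | Open, Open | Headed, Headed | Sought, Sought | Found, Found => true
  | Sought, Found => c
  | _, _ => false
  end.

Definition leaves (s : mode) (e : option edge_type) : bool :=
  match s with
  | Open => true
  | Headed => ~~ head_at_fst e
  | Sought => false
  | Found => head_at_fst e
  end.

Definition enters (e : option edge_type) (s : mode) (c : bool) : bool :=
  match s with
  | Open => ~~ head_at_snd e
  | Headed | Sought => head_at_snd e
  | Found => head_at_snd e && c
  end.

Section Moves.
Variables (V : finType) (G : mixed_graph V).
Implicit Types (C D Z : {set V}) (x y i j k v w : V) (s : mode).

(** Collider sections must meet C and non-collider sections must avoid D.  Keeping
    the two sets apart expresses that a connecting walk given C has, in addition,
    no vertex of D in its non-collider sections. *)
Definition move C D (a b : V * mode) : Prop :=
  [&& adjacent G a.1 b.1,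
      if is_line (G a.1 b.1) then continues a.2 b.2 (b.1 \in C)
      else leaves a.2 (G a.1 b.1) && enters (G a.1 b.1) b.2 (b.1 \in C)
    & noncollider b.2 ==> (b.1 \notin D)].

Definition moves C D := clos_refl_trans _ (move C D).

Definition arrives C D a j : Prop :=
  exists2 s, noncollider s & moves C D a (j, s).

Definition connected C i j : Prop := arrives C C (i, Open) j.

Lemma moves_l C D a b c : move C D a b -> moves C D b c -> moves C D a c.
Proof. by move=> ab; apply: rt_trans; apply: rt_step. Qed.

Lemma moves_r C D a b c : moves C D a b -> move C D b c -> moves C D a c.
Proof. by move=> ab bc; apply: rt_trans ab _; apply: rt_step. Qed.

Lemma move_line C D x y s : is_line (G x y) -> y \notin D ->
  move C D (x, s) (y, s).
Proof.
move=> line yD; apply/and3P; split; rewrite /= ?line ?yD ?implybT //.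
  by move: line; rewrite /adjacent; case: (G x y).
by case: s.
Qed.

Lemma moves_ind_l C D c (Q : V * mode -> Prop) :
  Q c -> (forall a b, move C D a b -> moves C D b c -> Q b -> Q a) ->
  forall a, moves C D a c -> Q a.
Proof.
move=> Qc step a ac; apply: (clos_refl_trans_ind_right _ _ _ _ Qc _ a ac).
by move=> a' b' ab Qb bc; apply: step ab bc Qb.
Qed.

Lemma moves_ind_r C D a (Q : V * mode -> Prop) :
  Q a -> (forall b c, moves C D a b -> move C D b c -> Q b -> Q c) ->
  forall c, moves C D a c -> Q c.
Proof.
move=> Qa step c ac; apply: (clos_refl_trans_ind_left _ _ _ _ Qa _ c ac).
by move=> b' c' ab Qb bc; apply: step ab bc Qb.
Qed.

Lemma moveS C C' D D' a b : C \subset C' -> D' \subset D ->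
  move C D a b -> move C' D' a b.
Proof.
move=> /subsetP CC' /subsetP DD' /and3P[ab ok avoid]; apply/and3P; split=> //.
  case: ifP ok => _; first by case: a.2; case: b.2 => //=; exact: CC'.
  case/andP=> -> /=; case: b.2 => //= /andP[-> /=]; exact: CC'.
by apply/implyP => /(implyP avoid); apply: contra; apply: DD'.
Qed.

Lemma movesS C C' D D' a b : C \subset C' -> D' \subset D ->
  moves C D a b -> moves C' D' a b.
Proof.
move=> CC' DD'; elim/moves_ind_r => [|b' c _ /(moveS CC' DD') bc ab].
  exact: rt_refl.
exact: moves_r ab bc.
Qed.

(** What the mode at the first vertex promises about the rest of the walk.  In mode
    [Sought] the flag is arbitrary since the section may have met C unnoticed. *)
Definition accepts C (a : V * mode) (p : seq V) : Prop :=
  match a.2 with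
  | Open => a.1 \notin C -> connecting_from G C false false a.1 p
  | Headed => a.1 \notin C -> connecting_from G C true false a.1 p
  | Sought => forall m, connecting_from G C true m a.1 p
  | Found => connecting_from G C true true a.1 p
  end.

Lemma connecting_from_met C h m m' x p : x \in C ->
  connecting_from G C h m x p = connecting_from G C h m' x p.
Proof. by move=> xC; case: p => [|y p] /=; rewrite xC !orbT. Qed.

Lemma accepts_step C a b p :
  move C C a b -> accepts C b p -> accepts C a (b.1 :: p).
Proof.
case: a b => [x s] [y s'] /and3P[/= _ ok avoid]; rewrite /accepts /=.
case: ifP ok => _.
  case: s; case: s' avoid => //= avoid.
  - by move=> _ H /negPf ->; apply: H.
  - by move=> _ H /negPf ->; apply: H.
  - by move=> yC H m; rewrite (connecting_from_met _ _ true).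
case/andP=> lv en acc.
have -> : connecting_from G C (head_at_snd (G x y)) false y p.
  case: s' avoid en acc => //= avoid.
  - by move=> /negPf -> H; apply: H.
  - by move=> -> H; apply: H.
  - by move=> -> H; apply: H.
  - by case/andP=> -> yC; rewrite (connecting_from_met _ _ true).
case: s lv => //= lv; rewrite ?andbT.
- by move/negPf=> ->.
- by move/negPf=> ->; rewrite (negPf lv).
- by rewrite lv.
Qed.

Lemma moves_connecting C a j s : noncollider s -> moves C C a (j, s) ->
  exists p, [/\ path (adjacent G) a.1 p, last a.1 p = j & accepts C a p].
Proof.
move=> ns; elim/moves_ind_l => [|a' b ab _ [p [bp lp acc]]].
  by exists [::]; split=> //; case: s ns => //= _ /=; rewrite /accepts /=.
exists (b.1 :: p); split=> //=; last exact: accepts_step ab acc.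
by case/and3P: ab => -> _ _.
Qed.

(** The guess is right when the section of [x] is a non-collider that avoids C, or
    a collider; the disjunction is over these two outcomes. *)
Lemma connecting_moves C h m x p : path (adjacent G) x p ->
  connecting_from G C h m x p ->
  exists2 s, noncollider s &
    ~~ (m || (x \in C)) /\ moves C C (x, if h then Headed else Open) (last x p, s) \/
    h /\ moves C C (x, if m || (x \in C) then Found else Sought) (last x p, s).
Proof.
elim: p h m x => [|y p IH] h m x /=.
  move=> _ mx; exists (if h then Headed else Open); first by case: h.
  by left; split=> //; apply: rt_refl.
case/andP=> xy yp; case: ifP => line.
  move=> /(IH _ _ _ yp)[s ns H]; exists s => //.
  case: H => [[mx ym]|[hT ym]]; [left|right]; split=> //.
  - by case/norP: mx.
  - apply: moves_l ym; apply/and3P; split=> //=; first by rewrite line; case: h.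
    by case/norP: mx => _ ->; rewrite implybT.
  - apply: moves_l ym; apply/and3P; split=> //=; last by case: ifP.
    by rewrite line; case: (m || _) => //=; case: ifP.
case/andP=> /eqP hd /(IH _ _ _ yp)[s ns H]; exists s => //.
have lv : leaves (if m || (x \in C) then Found else if h then Headed else Open) (G x y).
  by rewrite hd; case: h {hd} => //=; case E : head_at_fst => //=; rewrite E.
have L : moves C C
    (x, if m || (x \in C) then Found else if h then Headed else Open) (last y p, s).
  case: H => /= [[yC ym]|[hd' ym]]; apply: moves_l ym; apply/and3P; split=> //=.
  - by rewrite line lv; case: ifP => //= /negbT.
  - by rewrite yC implybT.
  - by rewrite line lv; case: (y \in C) => /=; rewrite hd'.
  - by case: ifP.
case: ifPn L => mx L; last by left.
by right; split=> //; move: hd; rewrite mx; case: (h).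
Qed.

Lemma separatedP C i j : i \notin C ->
  separated G [set i]%SET [set j]%SET C <-> ~ connected C i j.
Proof.
move=> iC; split=> [sep [s ns]|nconn x p xp /set1P xi /set1P lj].
  move/moves_connecting=> /(_ ns)[p [ip lj acc]]; apply: (sep i p) => //.
  - by rewrite inE.
  - by rewrite inE lj.
  - by apply/connecting_from_start; apply: acc.
subst x; move=> /connecting_from_start c; have [s ns H] := connecting_moves xp c.
apply: nconn.
by case: H => [[_]|[]] // xj; exists s; rewrite -?lj.
Qed.

Lemma adjacent_connected C i j : adjacent G i j -> j \notin C ->
  connected C i j.
Proof.
move=> ij jC.
case line: (is_line (G i j)).
  by exists Open => //; apply: rt_step; apply/and3P; split; rewrite //= ?line ?jC ?implybT.
by case hd : (head_at_snd (G i j)); [exists Headed|exists Open] => //;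
  apply: rt_step; apply/and3P; split; rewrite //= line hd.
Qed.

Lemma arrives_l C D a b j : move C D a b -> arrives C D b j -> arrives C D a j.
Proof. by move=> ab [s ns bj]; exists s => //; apply: moves_l ab bj. Qed.

Lemma arrives_r C D a b j : moves C D a b -> arrives C D b j -> arrives C D a j.
Proof. by move=> ab [s ns bj]; exists s => //; apply: rt_trans ab bj. Qed.

Lemma arrives_end C D s j : noncollider s -> arrives C D (j, s) j.
Proof. by move=> ns; exists s => //; apply: rt_refl. Qed.

Lemma arrivesS C C' D D' a j : C \subset C' -> D' \subset D ->
  arrives C D a j -> arrives C' D' a j.
Proof. by move=> CC DD [s ns aj]; exists s => //; apply: movesS aj. Qed.

Lemma arrives_ind C D j (Q : V * mode -> Prop) :
  (forall s, noncollider s -> Q (j, s)) ->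
  (forall a b, move C D a b -> arrives C D b j -> Q b -> Q a) ->
  forall a, arrives C D a j -> Q a.
Proof.
move=> base step a [s ns]; elim/moves_ind_l => [|a' b ab bj]; first exact: base.
by apply: step => //; exists s.
Qed.

(** [Open] constrains the way a section is left less than [Headed] does. *)
Lemma arrives_open C D x s j : noncollider s ->
  arrives C D (x, s) j -> arrives C D (x, Open) j.
Proof.
move=> ns aj.
suff H a : arrives C D a j -> noncollider a.2 -> arrives C D (a.1, Open) j.
  exact: (H (x, s)).
clear x s ns aj; elim/arrives_ind => [s' _ _|[x s] [y t] /and3P[/= xy ok yD] yj IH ns].
  exact: arrives_end.
move: ok; case: ifP => line ok.
  have nt : noncollider t by case: s t ns ok {yD yj IH} => [] [].
  apply: arrives_l (IH nt); apply/and3P; split; rewrite //= ?line //.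
  by move: yD; rewrite nt.
apply: arrives_l yj; apply/and3P; split; rewrite //= line.
by case/andP: ok => _ ->.
Qed.

(** Cut the walk at its last vertex of [Z] in a non-collider section: the rest is
    again connecting, as the first section of a walk is a non-collider. *)
Lemma last_visit C Z a j : j \notin Z -> arrives C C a j ->
  arrives C (C :|: Z)%SET a j \/
  exists2 z, z \in Z & arrives C (C :|: Z)%SET (z, Open) j.
Proof.
move=> jZ; elim/arrives_ind => [s ns|a' [y t] ab _ [yj|]]; last by right.
  by left; apply: arrives_end.
have [/andP[nt yZ]|avoid] := boolP (noncollider t && (y \in Z)).
  by right; exists y => //; apply: arrives_open yj.
left; apply: arrives_l yj; case/and3P: ab => xy ok yC; apply/and3P; split=> //.
by move: avoid yC; rewrite /= inE; case: noncollider => //= /negPf ->; rewrite orbF.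
Qed.

(** From its last visit to i or k in a non-collider section on, the walk uses
    neither of them there, so it stays connecting after conditioning on the one
    from which it does not start. *)
Lemma connected_intersection C i j k : j != i -> j != k ->
  connected C i j -> connected (k |: C)%SET i j \/ connected (i |: C)%SET k j.
Proof.
move=> ji jk ij; have jZ : j \notin [set i; k]%SET by rewrite !inE negb_or ji.
have H x y : [set x; y]%SET = [set i; k]%SET ->
    arrives C (C :|: [set i; k])%SET (y, Open) j -> connected (x |: C)%SET y j.
  move=> <-; apply: arrivesS; first exact: subsetUr.
  by rewrite setUC setUS // subsetUl.
case: (last_visit jZ ij) => [|[z /set2P[]->]]; [left|left|right]; apply: H => //.
- by rewrite setUC.
- by rewrite setUC.
Qed.

(** The mirror image of [last_visit] for a single vertex: cut the walk just before
    its first visit to k in a non-collider section. *)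
Lemma first_visit C a k : arrives C C a k ->
  (noncollider a.2 /\ a.1 = k) \/
  exists b s, [/\ moves C (k |: C)%SET a b, move C C b (k, s) & noncollider s].
Proof.
elim/arrives_ind => [s ns|a' [y t] ab _ [[nt /= yk]|[b [s [yb bk ns]]]]].
- by left.
- by right; exists a', t; split=> //; [apply: rt_refl|rewrite -yk].
have [/andP[nt /eqP yk]|avoid] := boolP (noncollider t && (y == k)).
  by right; exists a', t; split=> //; [apply: rt_refl|rewrite -yk].
right; exists b, s; split=> //; apply: moves_l yb.
case/and3P: ab => xy ok yC; apply/and3P; split=> //.
by move: avoid yC; rewrite /= !inE; case: noncollider => //= /negPf ->.
Qed.

(** A walk can be extended to the left by an arrowhead at its first vertex x, at
    the price that its first section may become a collider; [Found] then means
    that this section counts as meeting C. *)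
Lemma arrives_headed_or_found C D x j : arrives C D (x, Open) j ->
  arrives C D (x, Headed) j \/ arrives C D (x, Found) j.
Proof.
move=> aj; suff H a : arrives C D a j -> a.2 = Open ->
    arrives C D (a.1, Headed) j \/ arrives C D (a.1, Found) j by exact: H aj _.
clear x aj; elim/arrives_ind => [s _ _|[x s] [y t] /and3P[/= xy ok yD] yj IH so].
  by left; apply: arrives_end.
subst s; case line : (is_line (G x y)) ok => ok.
  have t_open : t = Open by case: t ok {yD yj IH}.
  subst t; have [yj'|yj'] := IH erefl; [left|right]; apply: arrives_l yj';
    by apply/and3P; split; rewrite //= line.
case hd : (head_at_fst (G x y)); [right|left]; apply: arrives_l yj;
  by apply/and3P; split; rewrite //= line hd.
Qed.

(** A section entered by an arrowhead can still be declared a collider. *)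
Lemma moves_sought C D i b : moves C D (i, Open) b -> b.2 = Headed ->
  moves C D (i, Open) (b.1, Sought).
Proof.
elim/moves_ind_r => // -[x s] [y t] ix /and3P[/= xy ok yD] IH tH; subst t.
case line : (is_line (G x y)) ok => ok.
  have s_headed : s = Headed by case: s ok {ix IH}.
  by apply: moves_r (IH s_headed) _; apply/and3P; split; rewrite //= line.
by apply: moves_r ix _; apply/and3P; split; rewrite //= line.
Qed.

(** Join a walk from i to k, cut at its first visit to k, and a walk from k to j,
    cut at its last visit.  The two sections at k merge.  If the result is a
    non-collider, the joined walk is connecting given C; if it is a collider, it
    contains k and no other non-collider section does, so the joined walk is
    connecting given C and k. *)
Lemma connected_transitivity C i j k : k != i -> k != j ->
  connected C i k -> connected C k j ->
  connected C i j \/ connected (k |: C)%SET i j.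
Proof.
move=> ki kj ik kj'.
have sub : C \subset (k |: C)%SET by apply: subsetUr.
have {}kj' : arrives C (k |: C)%SET (k, Open) j.
  have jk : j \notin [set k]%SET by rewrite inE eq_sym.
  rewrite setUC; have [//|[z]] := last_visit jk kj'.
  by rewrite inE => /eqP ->.
have kjC s : arrives C (k |: C)%SET (k, s) j -> arrives C C (k, s) j.
  exact: arrivesS.
have [[_ /= ik']|[[x t] [s [ix xk ns]]]] := first_visit ik.
  by rewrite ik' eqxx in ki.
have ixC : moves C C (i, Open) (x, t) by apply: movesS ix.
have [s_open|s_headed] : s = Open \/ s = Headed by case: s ns {xk}; [left|right..].
  by subst s; left; apply: arrives_r (moves_r ixC xk) (kjC _ kj').
subst s; have [kh|kf] := arrives_headed_or_found kj'.
  by left; apply: arrives_r (moves_r ixC xk) (kjC _ kh).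
right; apply: arrives_r (arrivesS sub (subxx _) kf).
have {}ix : moves (k |: C)%SET (k |: C)%SET (i, Open) (x, t) by apply: movesS ix.
case/and3P: xk => /= xk ok _; case line : (is_line (G x k)) ok => ok.
  have t_headed : t = Headed by case: t ok {ix ixC}.
  apply: moves_r (moves_sought ix t_headed) _.
  by apply/and3P; split; rewrite //= line !inE eqxx.
apply: moves_r ix _; apply/and3P; split; rewrite //= line !inE eqxx /=.
by case/andP: ok => -> ->.
Qed.

(** A walk from i stays among the vertices that [S] reaches from i, so it never
    meets v. *)
Lemma connected_unreachable (S : V -> V -> Prop) C i j v :
  (forall x y, adjacent G x y -> S x y) ->
  ~ clos_refl_trans _ S i v ->
  connected (v |: C)%SET i j -> connected C i j.
Proof.
move=> GS iv [s ns ij]; exists s => //.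
suff H b : moves (v |: C)%SET (v |: C)%SET (i, Open) b ->
    moves C C (i, Open) b /\ clos_refl_trans _ S i b.1 by case: (H _ ij).
elim/moves_ind_r => [|[x t] [y u] _ /and3P[/= xy ok yC] [ix Six]].
  by split; apply: rt_refl.
have Siy : clos_refl_trans _ S i y by apply: rt_trans Six _; apply: rt_step; apply: GS.
have yv : (y == v) = false by apply/eqP => yv; apply: iv; rewrite -yv.
split=> //; apply: moves_r ix _; move: ok yC; rewrite !inE yv => ok yC.
by apply/and3P; split.
Qed.

(** What a walk given C can do when a walk given C and v has reached the state [b].
    A collider section being traversed either avoids C, and is then also tried as
    a non-collider, or has met C.  A collider section that met only v is replaced
    by a detour from v that comes back to v without an arrowhead (mode [Open]);
    mode [Sought] is kept as well, in case a later vertex of the section is in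
    C. *)
Definition simulated C i (b : V * mode) : Prop :=
  let R s := moves C C (i, Open) (b.1, s) in
  match b.2 with
  | Open => R Open
  | Headed => R Headed
  | Sought => R Sought /\ (b.1 \notin C /\ R Headed \/ R Found)
  | Found => R Found \/ [/\ b.1 \notin C, R Open & R Sought]
  end.

Lemma simulated_leaves C i x s e : simulated C i (x, s) -> leaves s e ->
  exists2 s', moves C C (i, Open) (x, s') & leaves s' e.
Proof.
case: s => //= [ix _|ix le|[ix|[_ ix _]] le]; by [exists Open|exists Headed|exists Found].
Qed.

Lemma simulated_sought C C' D i x s y :
  simulated C i (x, s) -> move C' D (x, s) (y, Sought) -> simulated C i (y, Sought).
Proof.
move=> fx /and3P[/= xy ok _].
have mv s' t : moves C C (i, Open) (x, s') ->
    (if is_line (G x y) then continues s' t (y \in C)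
     else leaves s' (G x y) && enters (G x y) t (y \in C)) ->
    noncollider t ==> (y \notin C) -> moves C C (i, Open) (y, t).
  by move=> ix' ok' yC; apply: moves_r ix' _; apply/and3P.
move: ok mv; case: ifP => line ok mv.
  have s_sought : s = Sought by case: s ok {fx}.
  subst s; case: fx => ix /= fx; split; first exact: mv ix _ _.
  have [yC|yC] := boolP (y \in C); first by right; apply: mv ix _ _.
  by case: fx => [[_ ix']|ix']; [left; split=> //|right]; apply: mv ix' _ _.
case/andP: ok => le hd; have [s' ix' le'] := simulated_leaves fx le.
split; first by apply: mv ix' _ _; rewrite //= le'.
have [yC|yC] := boolP (y \in C); [right|left; split=> //];
  by apply: mv ix' _ _; rewrite //= le' ?hd ?yC.
Qed.

(** A collider section that meets C and v only in v becomes superfluous: at v,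
    either go to w in C and back, which makes w a collider, or puts w into the
    section if the edge is a line; or, if w is i, start afresh from i along the
    edge to v. *)
Lemma connected_anterior C i j v w :
  is_line (G v w) || is_arrow_to (G v w) -> w = i \/ w \in C ->
  v \notin C -> connected (v |: C)%SET i j -> connected C i j.
Proof.
move=> vw wiC vC.
have wv : adjacent G v w by move: vw; rewrite /adjacent; case: (G v w).
have vw' : adjacent G w v by move: wv; rewrite /adjacent (edge_sym G v w); case: (G v w).
have detour : simulated C i (v, Sought) -> simulated C i (v, Found).
  case=> iv [[_ iv']|]; last by left.
  case: wiC => [wi|wC].
    right; split=> //; rewrite -wi; apply: rt_step; apply/and3P; split=> //=.
    by move: vw; rewrite (edge_sym G v w); case: (G v w) => [[]|].
  case line : (is_line (G v w)).
    have iw : moves C C (i, Open) (w, Found).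
      by apply: moves_r iv _; apply/and3P; split; rewrite //= line.
    left; apply: moves_r iw _; apply/and3P; split=> //=.
    by move: line; rewrite (edge_sym G v w); case: (G v w) => [[]|].
  have iw : moves C C (i, Open) (w, Found).
    apply: moves_r iv' _; apply/and3P; split; rewrite //= line wC.
    by move: vw line; case: (G v w) => [[]|].
  right; split=> //; apply: moves_r iw _; apply/and3P; split=> //=.
  by move: vw line; rewrite (edge_sym G v w); case: (G v w) => [[]|].
suff H b : moves (v |: C)%SET (v |: C)%SET (i, Open) b -> simulated C i b.
  by case=> s ns /H; case: s ns => //= _ ij; [exists Open|exists Headed].
elim/moves_ind_r => [|[x s] [y t] _ xy fx]; first exact: rt_refl.
have mv s' t' : moves C C (i, Open) (x, s') ->
    (if is_line (G x y) then continues s' t' (y \in C)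
     else leaves s' (G x y) && enters (G x y) t' (y \in C)) ->
    noncollider t' ==> (y \notin C) -> moves C C (i, Open) (y, t').
  by case/and3P: xy => ? _ _ ix' ok' yC; apply: moves_r ix' _; apply/and3P.
case: t xy => xy.
- case/and3P: xy => /= _ ok; rewrite !inE negb_or => /andP[_ yC].
  case line : (is_line (G x y)) ok mv => ok mv.
    by case: s ok fx => // _ ix; apply: (mv Open).
  case/andP: ok => le en; have [s' ix' le'] := simulated_leaves fx le.
  by apply: (mv s'); rewrite //= le'.
- case/and3P: xy => /= _ ok; rewrite !inE negb_or => /andP[_ yC].
  case line : (is_line (G x y)) ok mv => ok mv.
    by case: s ok fx => // _ ix; apply: (mv Headed).
  case/andP: ok => le en; have [s' ix' le'] := simulated_leaves fx le.
  by apply: (mv s'); rewrite //= le'.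
- exact: simulated_sought fx xy.
(* Unless the section was [Found] before y, reaching y in mode [Found] could also
   have been done in mode [Sought], and v is left to the detour. *)
have sought : s <> Found \/ is_line (G x y) = false -> simulated C i (y, Sought).
  move=> s_found; apply: (@simulated_sought C (v |: C)%SET (v |: C)%SET) fx _.
  case/and3P: xy => /= xy ok _.
  apply/and3P; split=> //=; case: ifP ok s_found => line.
    by case: (s) => // _ [].
  by case/andP=> -> /andP[-> _].
case/and3P: (xy) => /= _ ok _.
case line : (is_line (G x y)) ok mv sought => ok mv sought.
  case: s ok fx {xy} mv sought => //= [yvC|_] fx mv sought.
    have {}sought : simulated C i (y, Sought) by apply: sought; left.
    case/setU1P: yvC => [yv|yC]; first by subst y; apply: detour.
    by case: sought => /= _ []; [rewrite yC; case|left].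
  case: fx => [ix|[_ ix ix']]; first by left; apply: mv ix _ _.
  have [yC|yC] := boolP (y \in C); first by left; apply: mv ix' _ _.
  by right; split=> //; [apply: mv ix _ _|apply: mv ix' _ _]; rewrite ?yC.
have {}sought : simulated C i (y, Sought) by apply: sought; right.
case/andP: ok => _ /andP[_ /setU1P[yv|yC]]; first by subst y; apply: detour.
by case: sought => /= _ []; [rewrite yC; case|left].
Qed.
End Moves.

(** * Graphs whose separations are those of an undirected graph *)

Section Undirected.
Variables (V : finType) (G : mixed_graph V).
Implicit Types (C : {set V}) (x y z i j k v w : V).

Definition inseparable x y : Prop :=
  forall C, x \notin C -> y \notin C -> connected G C x y.

(** The instance of upward stability that an edge from v to w yields when it is a
    line or an arrow. *)
Definition upward_stable v w : Prop :=
  forall C i j, i != j -> i \notin C -> j \notin C ->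
  v \notin i |: (j |: C) -> w \in i |: (j |: C) ->
  connected G (v |: C) i j -> connected G C i j.

Lemma setC_pair C i j : i \notin C -> j \notin C ->
  ~: (i |: (j |: C)) = set0 -> ~: [set i; j] = C.
Proof.
move=> iC jC /setP E; apply/setP => z; move: (E z); rewrite !inE.
case: eqVneq => [->|_]; first by rewrite (negPf iC).
by case: eqVneq => [->|_]; rewrite ?(negPf jC) //= => /negbFE ->.
Qed.

Lemma card_setC_U1 C z : z \notin C -> #|~: (z |: C)| < #|~: C|.
Proof.
move=> zC; apply: proper_card; apply/properP; split.
  by rewrite setCS subsetUr.
by exists z; rewrite !inE ?eqxx.
Qed.

(** [S] need not be the adjacency of G: inseparable vertices may be non-adjacent. *)
Variable S : rel V.

Definition avoiding C : rel V := [rel x y | S x y && (y \notin C)].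

Hypothesis S_irr : irreflexive S.
Hypothesis S_sym : symmetric S.
Hypothesis adjacentS : forall x y, adjacent G x y -> S x y.
Hypothesis S_inseparable : forall x y, S x y -> inseparable x y.
Hypothesis S_separable : forall x y, x != y -> ~~ S x y -> ~ inseparable x y.
Hypothesis connected_sym : forall C x y,
  x != y -> x \notin C -> y \notin C -> connected G C x y -> connected G C y x.
Hypothesis S_upward : forall v w, S v w -> upward_stable v w.

(** Induction on the path.  If its second vertex k is not j and i, j are separated
    given C, they are also separated given k and C, because k is an [S]-neighbour
    of i; singleton transitivity then contradicts the connections from i to k and
    from k to j. *)
Lemma connect_avoiding_connected C i j : i != j -> i \notin C ->
  connect (avoiding C) i j -> connected G C i j.
Proof.
move=> ij iC /connectP[p ip lj]; move: lj ij iC ip => ->.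
elim: p i => [|k p IH] i /=; first by rewrite eqxx.
move=> il iC /andP[/andP[ik kC] kp].
have [<-|kl] := eqVneq k (last k p); first exact: S_inseparable.
have lC : last k p \notin C.
  case/lastP: p kp {IH il kl} => //= p z.
  by rewrite rcons_path last_rcons => /and3P[].
have ki : k != i by apply/eqP => ki; rewrite ki S_irr in ik.
have ck : connected G C i k by apply: S_inseparable.
have [//|] := connected_transitivity ki kl ck (IH k kl kC kp).
have Ski : S k i by rewrite S_sym.
apply: (S_upward Ski) => //; last by rewrite !inE eqxx.
by rewrite !inE !negb_or ki kl.
Qed.

(** Enlarge a separating set one vertex at a time: stability allows every
    [S]-neighbour of i, j or C, and when there is none left, the other vertices
    lie in components of [S] that a walk from i cannot reach. *)
Lemma not_connected_given_rest i j :
  i != j -> ~~ S i j -> ~ connected G (~: [set i; j]) i j.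
Proof.
move=> ij Sij rest; apply: (S_separable ij Sij) => C iC jC.
apply: contrapT => sepC; move: rest; change (~ connected G (~: [set i; j]) i j).
have [m] := ubnP #|~: C|; elim: m => // m IH in C iC jC sepC *; rewrite ltnS => Cm.
have [E|[v vC]] := set_0Vmem (~: (i |: (j |: C))).
  by rewrite (setC_pair iC jC E).
have grow v' : v' \notin i |: (j |: C) ->
    (connected G (v' |: C) i j -> connected G C i j) -> ~ connected G (~: [set i; j]) i j.
  rewrite !inE !negb_or => /and3P[v'i v'j v'C] back.
  apply: (IH (v' |: C)).
  - by rewrite !inE negb_or eq_sym v'i.
  - by rewrite !inE negb_or eq_sym v'j.
  - by move/back.
  - exact: leq_trans (card_setC_U1 v'C) Cm.
rewrite inE in vC.
have [[v' [w [v'w v'B wB]]]|closed] :=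
  pselect (exists v' w, [/\ S v' w, v' \notin i |: (j |: C) & w \in i |: (j |: C)]).
  by apply: (grow v') => //; apply: (S_upward v'w).
apply: (grow v) => //; apply: connected_unreachable adjacentS _ => iv.
suff : v \in i |: (j |: C) by apply/negP.
elim/clos_refl_trans_ind_left: v / iv {vC} => [|y z _ yB yz].
  by rewrite !inE eqxx.
apply: contrapT => /negP zB; apply: closed; exists z, y; split=> //.
by rewrite S_sym.
Qed.

Lemma connect_avoidingS C C' i j : C \subset C' ->
  connect (avoiding C') i j -> connect (avoiding C) i j.
Proof.
move=> CC'; apply: connect_sub => x y /andP[xy yC']; apply: connect1.
by rewrite /avoiding /= xy; apply: contra yC'; apply/subsetP.
Qed.

(** Induction on the number of vertices outside C.  A further vertex k is cut off
    by C from i or from j, say from j; then the larger sets k, C and i, C separate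
    in [S] the pairs (i, j) and (k, j), and the intersection property gives the
    separation of i and j given C. *)
Lemma connected_connect_avoiding C i j : i != j -> i \notin C -> j \notin C ->
  connected G C i j -> connect (avoiding C) i j.
Proof.
have [m] := ubnP #|~: C|; elim: m => // m IH in C i j *; rewrite ltnS => Cm.
move=> ij iC jC cij; apply: contrapT => nij.
have grow x y z : x != y -> x != z -> y != z ->
    x \notin C -> y \notin C -> z \notin C ->
    ~ connect (avoiding C) x y -> ~ connected G (z |: C) x y.
  move=> xy xz yz xC yC zC nxy; move/IH => H; apply: nxy.
  apply: (connect_avoidingS (subsetUr [set z] C)).
  apply: H; rewrite ?inE ?negb_or ?xz ?yz //.
  exact: leq_trans (card_setC_U1 zC) Cm.
have [E|[k]] := set_0Vmem (~: (i |: (j |: C))).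
  have Sij : ~~ S i j by apply/negP => Sij; apply/nij/connect1/andP.
  by apply: (not_connected_given_rest ij Sij); rewrite (setC_pair iC jC E).
rewrite !inE !negb_or => /and3P[ki kj kC].
have [nkj|nik] : ~ connect (avoiding C) k j \/ ~ connect (avoiding C) i k.
  case: (boolP (connect (avoiding C) k j)) => kj'; [right=> ik|by left].
  by apply: nij; apply: connect_trans ik kj'.
  have [] : connected G (k |: C) i j \/ connected G (i |: C) k j.
    by apply: connected_intersection => //; rewrite eq_sym.
  - by apply: grow => //; rewrite eq_sym.
  - by apply: grow => //; rewrite eq_sym.
have cji : connected G C j i by apply: connected_sym.
have [] : connected G (k |: C) j i \/ connected G (j |: C) k i.
  by apply: connected_intersection => //; rewrite eq_sym.
- move/connected_sym => H; have {}H : connected G (k |: C) i j.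
    by apply: H; rewrite ?inE ?negb_or 1?eq_sym ?ij //= ?ki ?kj //= eq_sym ?ki ?kj.
  by move: H; apply: grow => //; rewrite eq_sym.
- move/connected_sym => H; have {}H : connected G (j |: C) i k.
    by apply: H; rewrite ?inE ?negb_or ?ki ?kj ?ij.
  by move: H; apply: grow => //; rewrite eq_sym.
Qed.
End Undirected.

(** * Conditional independence under a symmetry of the joint law *)

Section Marginals.
Local Open Scope classical_set_scope.
Context (disp : measure_display) (Omega : measurableType disp) (R : realType).
Variables (P : probability Omega R) (V : finType) (X : V -> {RV P >-> bool}).
Implicit Types (A B C : {set V}) (x y : V -> bool).

Lemma measurable_agree_on A x : measurable (agree_on X A x).
Proof.
have -> : agree_on X A x = \bigcap_(v in [set v | v \in A]) (X v @^-1` [set x v]).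
  by apply/seteqP; split=> w H v; apply: H.
by apply: fin_bigcap_measurable => // v _; apply: measurable_funPTI.
Qed.

Lemma agree_onI A B x : agree_on X A x `&` agree_on X B x = agree_on X (A :|: B)%SET x.
Proof.
apply/seteqP; split=> w.
  by move=> [HA HB] v /setUP[vA|vB]; [apply: HA|apply: HB].
by move=> H; split=> v vA; apply: H; rewrite inE vA ?orbT.
Qed.

(** Reduces marginals to the joint values, on which exchangeability is stated. *)
Lemma prob_agree_on A x :
  P (agree_on X A x) =
  (\sum_(y \in [set y : {ffun V -> bool} | forall v, v \in A -> y v = x v])
    P [set w | forall v, X v w = y v])%E.
Proof.
rewrite -measure_fin_bigcup; last 3 first.
- exact: finite_finset.
- by move=> y z _ _ [w [/= Hy Hz]]; apply/ffunP => v; rewrite -Hy Hz.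
- move=> y _; have := measurable_agree_on [set: V]%SET y.
  by congr measurable; apply/seteqP; split=> w H v => [|_]; apply: H; rewrite ?inE.
congr (P _); apply/seteqP; split=> w /=.
  move=> H; exists [ffun v => X v w] => /= v; rewrite ffunE //; exact: H.
  by case=> y /= yx H v vA; rewrite H yx.
Qed.

Section Invariance.
Variables (f g : V -> V) (fK : cancel f g) (gK : cancel g f).
Hypothesis joint_invariant : forall x,
  P [set w | forall v, X v w = x v] = P [set w | forall v, X v w = x (f v)].

Lemma prob_agree_on_invariant A x :
  P (agree_on X (f @^-1: A) (x \o f)) = P (agree_on X A x).
Proof.
rewrite !prob_agree_on.
rewrite (reindex_fsbig (fun y : {ffun V -> bool} => [ffun v => y (f v)])
  [set y : {ffun V -> bool} | forall v, v \in A -> y v = x v]).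
  apply: eq_fsbigr => y _; rewrite [RHS]joint_invariant.
  by congr (P _); apply/seteqP; split=> w /= H v; rewrite H ffunE.
split.
- by move=> y /= yx v; rewrite inE ffunE => /yx.
- move=> y z _ _ /ffunP yz; apply/ffunP => v.
  by have := yz (g v); rewrite !ffunE gK.
- move=> y /= yx; exists [ffun v => y (g v)] => /=.
    by move=> v vA; rewrite ffunE yx /= ?inE gK.
  by apply/ffunP => v; rewrite !ffunE fK.
Qed.

Lemma cond_indep_invariant A B C : cond_indep X A B C ->
  cond_indep X (f @^-1: A) (f @^-1: B) (f @^-1: C).
Proof.
move=> indep x; have -> : x = (x \o g) \o f by apply/funext => v /=; rewrite fK.
rewrite /cond_prob !agree_onI -!preimsetU !prob_agree_on_invariant -!agree_onI.
exact: indep.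
Qed.
End Invariance.

Lemma cond_indep_sym A B C : cond_indep X A B C -> cond_indep X B A C.
Proof. by move=> indep x C0; rewrite classical_sets.setIC indep // GRing.mulrC. Qed.

End Marginals.

(** * Comparing graphs; permutations of the nodes *)

Section Graphs.
Variables (V : finType) (G : mixed_graph V).
Implicit Types (C : {set V}).

Lemma markov_equivalent_connected (H : mixed_graph V) :
  (forall (C : {set V}) i j, i != j -> i \notin C -> j \notin C ->
     connected G C i j <-> connected H C i j) ->
  markov_equivalent G H.
Proof.
(* Single vertices suffice, as a walk has two ends. *)
have main (K L : mixed_graph V) :
    (forall (C : {set V}) i j, i != j -> i \notin C -> j \notin C ->
       connected L C i j -> connected K C i j) ->
    forall A B C, pairwise_disjoint A B C -> separated K A B C -> separated L A B C.
  move=> LK A B C [/pred0P AB /pred0P AC /pred0P BC] sepK x p xp xA lB conn.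
  have xC : x \notin C by apply/negP => xC; have := AC x; rewrite /= xA xC.
  have lC : last x p \notin C by apply/negP => lC; have := BC (last x p); rewrite /= lB lC.
  have xl : x != last x p by apply/eqP => E; have := AB x; rewrite /= xA E lB.
  suff : separated K [set x] [set last x p] C.
    move/(separatedP _ _ xC); apply; apply: LK => //; apply: contrapT.
    by move/(separatedP _ _ xC) => H0; apply: (H0 x p) => //; rewrite inE.
  by move=> y q yq /set1P yx /set1P lq; subst y; apply: sepK; rewrite ?lq.
by move=> GH A B C dis; split; apply: main dis => C' i j ij iC jC /GH; apply.
Qed.

Lemma mixed_graph_eq (H : mixed_graph V) : (forall u v, G u v = H u v) -> G = H.
Proof.
case: G H => [e irr sym] [e' irr' sym'] /= ee.
have {}ee : e = e' by apply/funext => u; apply/funext.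
by subst e'; congr MixedGraph; exact: Prop_irrelevance.
Qed.
End Graphs.

Section Uniform.
Variables (V : finType) (e : rel V) (e_sym : symmetric e).

(** [share_node] is reflexive, while [uniform_graph] ignores loops. *)
Definition loopless : rel V := [rel x y | (x != y) && e x y].

(** A walk of lines is one section, and a non-collider. *)
Lemma connected_lines (C : {set V}) i j : i \notin C ->
  connected (uniform_graph (erefl : rev_edge_type Line = Line) e_sym) C i j <->
  connect (avoiding loopless C) i j.
Proof.
set H := uniform_graph _ _.
have HL x y : H x y = if loopless x y then Some Line else None by [].
move=> iC; split.
  case=> s _ ij; suff : connect (avoiding loopless C) i (j, s).1 /\ (j, s).2 = Open by case.
  elim/moves_ind_r: ij => [|[x t] [y u] _ /and3P[]]; first by rewrite connect0.
  rewrite /adjacent HL; case: ifP => //= xy _ ok yC [ix t_open].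
  move: ok yC; rewrite t_open /=; case: u => //= _ yC; split=> //.
  by apply: connect_trans ix _; apply: connect1; apply/andP.
case/connectP=> p ip ->; exists Open => //.
elim: p i ip {iC} => [|y p IH] x /=; first by move=> _; apply: rt_refl.
case/andP=> /andP[xy yC] yp; apply: moves_l (IH y yp).
by apply: move_line; rewrite ?HL ?xy.
Qed.

End Uniform.

Lemma perm_of_seq (T : finType) (s t : seq T) : uniq s -> uniq t -> size s = size t ->
  exists f : {perm T}, map f s = t.
Proof.
elim: s t => [|x s IH] [|y t] //=; first by exists 1%g.
move=> /andP[xs us] /andP[yt ut] [/(IH _ us ut)[f ft]].
exists (f * tperm (f x) y)%g; rewrite permM tpermL; congr (_ :: _).
rewrite -[RHS]ft; apply/eq_in_map => z zs; rewrite permM tpermD //.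
  by apply: contra xs => /eqP/perm_inj ->.
by apply: contra yt => /eqP ->; rewrite -ft map_f.
Qed.

Section Dyads.
Variable N : finType.
Implicit Types (d : dyad N) (s : {perm N}).

Lemma dyad_permK s : cancel (dyad_perm s) (dyad_perm s^-1).
Proof.
move=> d; apply: val_inj => /=; rewrite -imset_comp -[RHS]imset_id.
by apply: eq_imset => x /=; rewrite permK.
Qed.

Lemma dyad_permKV s : cancel (dyad_perm s^-1) (dyad_perm s).
Proof. by move=> d; rewrite -{1}(invgK s) dyad_permK. Qed.

Lemma dyad_perm_pair s d a b a' b' d' : s a = a' -> s b = b' ->
  val d = [set a; b] -> val d' = [set a'; b'] -> dyad_perm s d = d'.
Proof.
by move=> sa sb da da'; apply: val_inj; rewrite /= da da' imsetU1 imset_set1 sa sb.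
Qed.

Lemma share_node_nodes d d' : d != d' -> share_node d d' ->
  exists a b c, [/\ uniq [:: a; b; c], val d = [set a; b] & val d' = [set a; c]].
Proof.
move=> dd' /existsP[a /andP[ad ad']].
have other (x : dyad N) : a \in val x -> exists2 b, a != b & val x = [set a; b].
  move=> ax; have /cards2P[u [v [uv E]]] := valP x.
  move: ax; rewrite E => /set2P[] ->; first by exists v.
  by exists u; rewrite 1?eq_sym // setUC.
have [b ab db] := other d ad; have [c ac dc] := other d' ad'.
exists a, b, c; split=> //=; rewrite !inE negb_or ab ac /= andbT.
by apply: contra dd' => /eqP bc; rewrite -val_eqE db dc bc.
Qed.

Lemma share_no_node_nodes d d' : share_no_node d d' ->
  exists a b c e, [/\ uniq [:: a; b; c; e], val d = [set a; b] & val d' = [set c; e]].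
Proof.
move=> /existsPn dd'.
have /cards2P[a [b [ab dab]]] := valP d; have /cards2P[c [e [ce dce]]] := valP d'.
exists a, b, c, e; split=> //=; have := dd' a; have := dd' b.
rewrite dab dce !inE !eqxx ?orbT /= !negb_or => /andP[bc be] /andP[ac ae].
by rewrite ab ac ae bc be ce.
Qed.

Lemma share_node_orbit d1 d2 d1' d2' : d1 != d2 -> d1' != d2' ->
  share_node d1 d2 -> share_node d1' d2' ->
  exists s, dyad_perm s d1 = d1' /\ dyad_perm s d2 = d2'.
Proof.
move=> nd nd' /(share_node_nodes nd)[a [b [c [u E1 E2]]]].
move=> /(share_node_nodes nd')[a' [b' [c' [u' E1' E2']]]].
have [s [sa sb sc]] := perm_of_seq u u' erefl.
by exists s; split; [apply: dyad_perm_pair E1 E1'|apply: dyad_perm_pair E2 E2'].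
Qed.

Lemma share_no_node_orbit d1 d2 d1' d2' :
  share_no_node d1 d2 -> share_no_node d1' d2' ->
  exists s, dyad_perm s d1 = d1' /\ dyad_perm s d2 = d2'.
Proof.
move=> /share_no_node_nodes[a [b [c [e [u E1 E2]]]]].
move=> /share_no_node_nodes[a' [b' [c' [e' [u' E1' E2']]]]].
have [s [sa sb sc se]] := perm_of_seq u u' erefl.
by exists s; split; [apply: dyad_perm_pair E1 E1'|apply: dyad_perm_pair E2 E2'].
Qed.

End Dyads.

(** * Separations of a graph faithful to an exchangeable network *)

(** In a bidirected graph every inner vertex of a walk is a collider section, which
    cannot meet the empty set; so the walk is a single edge. *)
Lemma connected_set0_adjacent (V : finType) (G : mixed_graph V) u v :
  (forall x y, ~~ (is_line (G x y) || is_arrow_to (G x y))) ->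
  u != v -> connected G set0 u v -> adjacent G u v.
Proof.
move=> arcs uv [s ns uvs].
have arc x y : adjacent G x y -> G x y = Some Arc.
  move=> xy; have := arcs x y; have := arcs y x; move: xy.
  by rewrite /adjacent (edge_sym G x y); case: (G x y) => [[]|].
suff : (v, s) = (u, Open) \/
    adjacent G u (v, s).1 /\ ((v, s).2 = Headed \/ (v, s).2 = Sought).
  by case=> [[vu _]|[] //]; rewrite vu eqxx in uv.
elim/moves_ind_r: uvs => [|[x t] [y t'] _ /and3P[/= xy ok _] IH]; first by left.
right; move: ok; rewrite (arc _ _ xy) /= inE.
case: IH => [[xu t_open]|[_ [t_headed|t_sought]]]; last 2 first.
- by rewrite /= in t_headed; rewrite t_headed.
- by rewrite /= in t_sought; rewrite t_sought.
by rewrite t_open -xu; case: t' => //= _; split=> //; [left|right].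
Qed.

Section Faithful.
Context (N : finType) (disp : measure_display) (Omega : measurableType disp)
  (R : realType) (P : probability Omega R) (X : dyad N -> {RV P >-> bool})
  (G : mixed_graph (dyad N)).
Hypotheses (X_exch : exchangeable X) (G_faithful : faithful X G).
Implicit Types (C : {set dyad N}) (i j v w x y : dyad N) (s : {perm N}).

Lemma connected_cond_indep C i j : i != j -> i \notin C -> j \notin C ->
  connected G C i j <-> ~ cond_indep X [set i] [set j] C.
Proof.
move=> ij iC jC.
have dis : pairwise_disjoint [set i] [set j] C.
  by split; rewrite ?disjoints1 ?inE // eq_sym.
rewrite -(G_faithful dis) (separatedP _ _ iC).
by split=> [cij|/contrapT//]; apply.
Qed.

(** Symmetry is taken from conditional independence, where it is immediate. *)
Lemma faithful_connected_sym C i j : i != j -> i \notin C -> j \notin C ->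
  connected G C i j -> connected G C j i.
Proof.
move=> ij iC jC /(connected_cond_indep ij iC jC) dep.
by apply/connected_cond_indep; rewrite 1?eq_sym // => /cond_indep_sym.
Qed.

Lemma dyad_perm_inj s : injective (dyad_perm s).
Proof. exact: can_inj (dyad_permK s). Qed.

Lemma connected_dyad_perm s C i j : i != j -> i \notin C -> j \notin C ->
  connected G C i j ->
  connected G (dyad_perm s @: C) (dyad_perm s i) (dyad_perm s j).
Proof.
move=> ij iC jC /(connected_cond_indep ij iC jC) dep.
have inj := @dyad_perm_inj s.
apply/connected_cond_indep; rewrite ?(inj_eq inj) ?mem_imset //.
move=> /(cond_indep_invariant (dyad_permK s) (dyad_permKV s) (X_exch s)).
have pre (A : {set dyad N}) : dyad_perm s @^-1: (dyad_perm s @: A) = A.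
  by apply/setP => x; rewrite inE mem_imset.
have pre1 i' : dyad_perm s @^-1: [set dyad_perm s i'] = [set i'].
  by rewrite -imset_set1 pre.
by rewrite !pre1 pre.
Qed.

Lemma dyad_perm_imsetKV s C : dyad_perm s @: (dyad_perm s^-1 @: C) = C.
Proof.
rewrite -imset_comp -[RHS]imset_id; apply: eq_imset => x /=.
exact: dyad_permKV.
Qed.

Lemma dyad_perm_imsetK s C : dyad_perm s^-1 @: (dyad_perm s @: C) = C.
Proof. by have := dyad_perm_imsetKV s^-1 C; rewrite invgK. Qed.

Lemma inseparable_dyad_perm s x y : x != y -> inseparable G x y ->
  inseparable G (dyad_perm s x) (dyad_perm s y).
Proof.
move=> xy xyi C; rewrite -(dyad_perm_imsetKV s C) !mem_imset; try exact: dyad_perm_inj.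
by move=> xC yC; apply: connected_dyad_perm => //; apply: xyi.
Qed.

Lemma edge_upward_stable v w :
  is_line (G v w) || is_arrow_to (G v w) -> upward_stable G v w.
Proof.
move=> vw C i j ij iC jC; rewrite !inE !negb_or => /and3P[vi vj vC].
case/or3P=> [/eqP wi|/eqP wj|wC].
- by apply: connected_anterior vw _ vC; left.
- have ji : j != i by rewrite eq_sym.
  move/faithful_connected_sym => H; apply: faithful_connected_sym => //.
  apply: (connected_anterior vw _ vC); first by left.
  by apply: H; rewrite // !inE negb_or eq_sym ?vi ?vj.
- by apply: connected_anterior vw _ vC; right.
Qed.

Lemma upward_stable_dyad_perm s v w : upward_stable G v w ->
  upward_stable G (dyad_perm s v) (dyad_perm s w).
Proof.
move=> ant C i j; rewrite -(dyad_perm_imsetKV s C) -(dyad_permKV s i) -(dyad_permKV s j).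
move: (dyad_perm s^-1 @: C) (dyad_perm s^-1 i) (dyad_perm s^-1 j) => {}C {}i {}j.
have inj := @dyad_perm_inj s.
rewrite -!imsetU1 !mem_imset // (inj_eq inj) => ij iC jC vB wB.
have [vi vj] : v != i /\ v != j.
  by move: vB; rewrite !inE !negb_or => /and3P[-> ->].
move/(connected_dyad_perm s^-1) => H; apply: connected_dyad_perm => //.
apply: (ant C i j ij iC jC vB wB).
have := H; rewrite !dyad_permK dyad_perm_imsetK; apply.
- by rewrite (inj_eq inj).
- by rewrite mem_imset // !inE negb_or eq_sym vi.
- by rewrite mem_imset // !inE negb_or eq_sym vj.
Qed.

Lemma adjacent_inseparable x y : adjacent G x y -> inseparable G x y.
Proof. by move=> xy C _ yC; apply: adjacent_connected. Qed.

Lemma adjacent_neq x y : adjacent G x y -> x != y.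
Proof.
by move=> xy; apply/eqP => E; move: xy; rewrite E /adjacent edge_irrefl.
Qed.

(** [e] stands for [share_node] and for [share_no_node]. *)
Section OneOrbit.
Variables (e : rel (dyad N)) (e_sym : symmetric e).
Hypothesis e_orbit : forall x y x' y', x != y -> x' != y' -> e x y -> e x' y' ->
  exists s, dyad_perm s x = x' /\ dyad_perm s y = y'.

Lemma orbit_inseparable :
  (forall x y, x != y -> e x y -> inseparable G x y) \/
  (forall x y, x != y -> e x y -> ~ inseparable G x y).
Proof.
have [[x [y [xy exy ins]]]|none] :=
  pselect (exists x y, [/\ x != y, e x y & inseparable G x y]); [left|right].
  move=> x' y' xy' exy'; have [s [<- <-]] := e_orbit xy xy' exy exy'.
  exact: inseparable_dyad_perm.
by move=> x y xy exy ins; apply: none; exists x, y.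
Qed.

Hypothesis e_inseparable : forall x y, x != y -> e x y -> inseparable G x y.
Hypothesis e_separable : forall x y, x != y -> ~~ e x y -> ~ inseparable G x y.

(** A line or arrow of G joins a pair in [e], and by symmetry its stability property
    spreads to all of [e]. *)
Lemma uniform_markov :
  markov_equivalent G (uniform_graph (erefl : rev_edge_type Line = Line) e_sym) \/
  markov_equivalent G (uniform_graph (erefl : rev_edge_type Arc = Arc) e_sym).
Proof.
have adj_e x y : adjacent G x y -> loopless e x y.
  move=> xy; have nxy := adjacent_neq xy; apply/andP; split=> //.
  by apply: contrapT => /negP/(e_separable nxy); apply; apply: adjacent_inseparable.
have [[v [w vw]]|arcs] := pselect (exists v w, is_line (G v w) || is_arrow_to (G v w)).
  left; apply: markov_equivalent_connected => C i j ij iC jC.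
  rewrite connected_lines //.
  have irr : irreflexive (loopless e) by move=> x; rewrite /loopless /= eqxx.
  have sym : symmetric (loopless e) by move=> x y; rewrite /loopless /= eq_sym e_sym.
  have ins x y : loopless e x y -> inseparable G x y.
    by case/andP=> xy exy; apply: e_inseparable.
  have /andP[nvw evw] : loopless e v w.
    by apply: adj_e; move: vw; rewrite /adjacent; case: (G v w).
  have up v' w' : loopless e v' w' -> upward_stable G v' w'.
    case/andP=> nvw' evw'; have [s [<- <-]] := e_orbit nvw nvw' evw evw'.
    exact: upward_stable_dyad_perm (edge_upward_stable vw).
  split; last exact: (connect_avoiding_connected irr sym ins up).
  apply: (connected_connect_avoiding sym adj_e) => // [x y xy nxy|C' x y].
    by apply: e_separable => //; move: nxy; rewrite /loopless /= xy.
  exact: faithful_connected_sym.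
right; have {}arcs x y : ~~ (is_line (G x y) || is_arrow_to (G x y)).
  by apply/negP => xy; apply: arcs; exists x, y.
suff <- : G = uniform_graph (erefl : rev_edge_type Arc = Arc) e_sym by move=> A B C _.
apply: mixed_graph_eq => x y; rewrite /= /uniform_edge.
case: ifPn => [/andP[xy exy]|nxy].
  have := connected_set0_adjacent arcs xy (e_inseparable xy exy _ _).
  rewrite !inE => /(_ isT isT).
  have := arcs x y; have := arcs y x.
  by rewrite /adjacent (edge_sym G x y); case: (G x y) => [[]|].
case E : (G x y) => // [t]; case/negP: nxy; apply: adj_e.
by rewrite /adjacent E.
Qed.
End OneOrbit.

End Faithful.

Theorem theorem2 (N : finType)
    (disp : measure_display) (Omega : measurableType disp) (R : realType)
    (P : probability Omega R) (X : dyad N -> {RV P >-> bool})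
    (G : mixed_graph (dyad N)) :
  exchangeable X -> chain_mixed G -> faithful X G ->
  markov_equivalent G (empty_graph (dyad N)) \/
  markov_equivalent G (incidence_lines N) \/
  markov_equivalent G (incidence_arcs N) \/
  markov_equivalent G (incidence_compl_lines N) \/
  markov_equivalent G (incidence_compl_arcs N) \/
  markov_equivalent G (complete_graph (dyad N)).
Proof.
move=> X_exch _ G_faithful.
have [share_ins|share_sep] := orbit_inseparable X_exch G_faithful (@share_node_orbit N);
have [no_ins|no_sep] := orbit_inseparable X_exch G_faithful
  (fun x y x' y' _ _ => @share_no_node_orbit N x y x' y').
- do 5!right; apply: markov_equivalent_connected => C x y xy xC yC.
  split=> _.
    by apply: adjacent_connected => //; rewrite /adjacent /= /uniform_edge xy.
  case: (boolP (share_node x y)) => shr; first exact: share_ins.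
  exact: no_ins.
- have [||mk|mk] := uniform_markov X_exch G_faithful (@share_node_sym N) (@share_node_orbit N).
  + exact: share_ins.
  + exact: no_sep.
  + by right; left.
  + by do 2!right; left.
- have [||mk|mk] := uniform_markov X_exch G_faithful (@share_no_node_sym N)
    (fun x y x' y' _ _ => @share_no_node_orbit N x y x' y').
  + exact: no_ins.
  + by move=> x y xy /negPn; apply: share_sep.
  + by do 3!right; left.
  + by do 4!right; left.
- left; suff -> : G = empty_graph (dyad N) by move=> A B C _.
  apply: mixed_graph_eq => x y /=; case E : (G x y) => // [t].
  have xy : adjacent G x y by rewrite /adjacent E.
  have ins := adjacent_inseparable xy; have nxy := adjacent_neq xy.
  by case: (boolP (share_node x y)) => shr; [case: (share_sep x y)|case: (no_sep x y)].
Qed.
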